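(* Let $P=T_1\times\cdots\times T_n$ be a finite product of locally finite trees (each factor equipped with its path metric) and let $G$ be a group acting on $P$ by automorphisms (and hence by isometries). Then the following five conditions are equivalent: (i) $G$ acts metrically properly on $P$. (ii) $G$ acts properly on $P$, meaning that for every compact $C\subseteq P$ the set $\{g\in G: g(C)\cap C\ne\emptyset\}$ is finite. (iii) For all vertices $v$ of $P$, the stabiliser $G_v$ is a finite group. (iv) $G$ acts properly discontinuously on $P$. (v) The homomorphism $h:G\to\mathrm{Aut}(P)$ given by the action has finite kernel and $h(G)$ is a discrete subgroup of $\mathrm{Aut}(P)\le\mathrm{Isom}(P)$ with the compact open topology (equivalently, the topology of pointwise convergence).
   Context: Trees are simplicial trees with the path metric; locally finite means every vertex has finite degree. The product $P$ carries the obvious cube complex structure and the $\ell_2$ product metric; $\mathrm{Aut}(P)$ is the group of automorphisms preserving the cube complex structure (possibly permuting factors). Metrically properly: for every bounded $C\subseteq P$ the set $\{g\in G: g(C)\cap C\neq\emptyset\}$ is finite. Properly discontinuously: every point $x\in P$ has an open neighbourhood $U$ such that $\{g\in G: U\cap g(U)\neq\emptyset\}$ is finite. The compact open topology on $\mathrm{Isom}(P)$ has as sub-basis the sets $\{f\in\mathrm{Isom}(P): f(K)\subseteq U\}$ for $K$ compact and $U$ open in $P$. *)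

(* Defs.v *)
From HB Require Import structures.
From mathcomp Require Import all_boot all_order all_algebra.
From mathcomp Require Import all_classical all_reals topology.
From mathcomp Require Import ring.
Set Implicit Arguments.
Unset Strict Implicit.
Unset Printing Implicit Defensive.
Import Order.TTheory GRing.Theory Num.Theory.
Local Open Scope classical_set_scope.
Local Open Scope ring_scope.

(** * Simplicial trees *)

Record tree := Tree {
  vertex :> eqType;
  adj : rel vertex;
  adj_sym : symmetric adj;
  adj_irr : irreflexive adj;
  tree_inhabited : inhabited vertex;
  tree_connected : forall u v, exists2 p, path adj u p & last u p = v;
  tree_acyclic : forall c : seq vertex, ucycle adj c -> (size c <= 2)%N
}.

Definition locally_finite (T : tree) :=
  forall v : T, finite_set [set w | adj v w].

(** * Geometric realisation of a tree *)

Section Realisation.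
Variables (R : realType) (T : tree).

(* [u] and [v] span a simplex, which is a vertex when [u = v] *)
Definition simplex (u v : T) := (u == v) || adj u v.

(* barycentric coordinates of the point [(1 - t) u + t v] *)
Definition barycenter (u v : T) (t : R) : T -> R :=
  fun w => (1 - t) * (w == u)%:R + t * (w == v)%:R.

Record realisation := Realisation {
  bary :> T -> R;
  baryP : exists u v, simplex u v /\
    exists2 t, 0 <= t <= 1 & bary = barycenter u v t
}.

Definition cell (u v : T) : set realisation :=
  [set x | exists2 t, 0 <= t <= 1 & bary x = barycenter u v t].

Definition is_vertex (x : realisation) := exists v, cell v v x.

(* [polyline x y l]: there is a path of length [l] from [x] to [y] made of
   finitely many segments, each contained in an edge; along an edge [u v] of
   length 1 the coordinate [u] is an arc length parameter *)
Inductive polyline : realisation -> realisation -> R -> Prop :=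
| polyline_nil x : polyline x x 0
| polyline_cons u v x y z l : adj u v -> cell u v x -> cell u v y ->
    polyline y z l -> polyline x z (`|x u - y u| + l).

Definition path_dist (x y : realisation) : R := inf [set l | polyline x y l].

Lemma realisation_eq (x y : realisation) : bary x = bary y -> x = y.
Proof.
case: x y => [x xP] [y yP] /= xy; rewrite {}xy in xP *.
by congr Realisation; exact: Prop_irrelevance.
Qed.

Lemma cell_coord u v x y w : adj u v -> cell u v x -> cell u v y ->
  `|x w - y w| <= `|x u - y u|.
Proof.
move=> uv [t t01 xt] [s s01 ys]; rewrite xt ys /barycenter.
have nuv : (u == v) = false by apply/negP => /eqP e; rewrite e adj_irr in uv.
rewrite eqxx nuv.
case: (eqVneq w u) => [->|_].
  by rewrite nuv.
case: (w == v) => /=; last by rewrite !mulr0 !addr0 subrr normr0.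
rewrite !mulr0 !mulr1 !add0r !addr0.
have -> : 1 - t - (1 - s) = s - t by ring.
by rewrite (distrC s t).
Qed.

Lemma polyline_ge_coord x y l w : polyline x y l -> `|x w - y w| <= l.
Proof.
elim=> [z|u v {}x {}y z {}l uv xc yc _ ih]; first by rewrite subrr normr0.
rewrite (le_trans (ler_distD (y w) _ _))// lerD//; exact: cell_coord uv _ _.
Qed.

Lemma polyline_ge0 x y l : polyline x y l -> 0 <= l.
Proof. by elim=> // *; rewrite addr_ge0. Qed.

Lemma polyline_cat x y z l l' :
  polyline x y l -> polyline y z l' -> polyline x z (l + l').
Proof.
elim=> [?|u v {}x {}y t {}l uv xc yc _ ih]; first by rewrite add0r.
by move=> /ih; rewrite -addrA; exact: polyline_cons uv xc yc.
Qed.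

Lemma polyline_edge u v x y : adj u v -> cell u v x -> cell u v y ->
  polyline x y `|x u - y u|.
Proof.
move=> uv xc yc; rewrite -[`|_|]addr0.
by apply: polyline_cons uv xc yc _; exact: polyline_nil.
Qed.

Lemma polyline_rev x y l : polyline x y l -> polyline y x l.
Proof.
elim=> [z|u v {}x {}y z {}l uv xc yc _ ih]; first exact: polyline_nil.
rewrite addrC; apply: polyline_cat ih _.
by rewrite distrC; exact: polyline_edge uv _ _.
Qed.

Lemma vertex_baryP (u : T) : exists a b, simplex a b /\
  exists2 t, 0 <= t <= 1 & barycenter u u 0 = barycenter a b t.
Proof.
exists u, u; split; first by rewrite /simplex eqxx.
by exists 0 => //; rewrite lexx ler01.
Qed.

Definition vertex_point (u : T) := Realisation (vertex_baryP u).

Lemma cell_left u v : cell u v (vertex_point u).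
Proof.
exists 0; first by rewrite lexx ler01.
by apply/funext => w; rewrite /= /barycenter !mul0r.
Qed.

Lemma cell_right u v : cell u v (vertex_point v).
Proof.
exists 1; first by rewrite ler01 lexx.
by apply/funext => w; rewrite /= /barycenter; ring.
Qed.

Lemma polyline_vertex x : exists u l, polyline x (vertex_point u) l.
Proof.
have [u [v [/orP[/eqP <-|uv] [t t01 xt]]]] := baryP x.
- exists u, 0; rewrite (_ : vertex_point u = x); first exact: polyline_nil.
  by apply: realisation_eq; rewrite xt; apply/funext => w /=;
    rewrite /barycenter; ring.
- exists u; eexists; apply: (polyline_edge uv); last exact: cell_left.
  by exists t.
Qed.

Lemma polyline_exists x y : exists l, polyline x y l.
Proof.
have [u [l xu]] := polyline_vertex x; have [v [l' yv]] := polyline_vertex y.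
suff [m uv] : exists m, polyline (vertex_point u) (vertex_point v) m.
  exists (l + (m + l')); apply: polyline_cat xu _; apply: polyline_cat uv _.
  exact: polyline_rev.
have [p pp <-] := tree_connected u v.
elim: p u pp {xu} => [|w p ih] u /=; first by exists 0; exact: polyline_nil.
move=> /andP[uw /ih[m pm]]; eexists; apply: (polyline_cons uw) pm.
  exact: cell_left.
exact: cell_right.
Qed.

Lemma path_dist_lb x y : has_lbound [set l | polyline x y l].
Proof. by exists 0 => l; exact: polyline_ge0. Qed.

Lemma path_dist_le x y l : polyline x y l -> path_dist x y <= l.
Proof. by move=> xyl; apply: ge_inf => //; exact: path_dist_lb. Qed.

Lemma path_dist_ge x y (c : R) :
  (forall l, polyline x y l -> c <= l) -> c <= path_dist x y.
Proof.
move=> h; apply: lb_le_inf => [|l]; last exact: h.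
by have [l] := polyline_exists x y; exists l.
Qed.

Lemma path_dist_approx x y (e : R) : 0 < e ->
  exists2 l, polyline x y l & l <= path_dist x y + e.
Proof.
move=> e0; have [|l xyl /ltW ?] := @inf_adherent R [set l | polyline x y l] e e0.
  split; last exact: path_dist_lb.
  by have [l] := polyline_exists x y; exists l.
by exists l.
Qed.

Lemma path_distxx x : path_dist x x = 0.
Proof.
apply/eqP; rewrite eq_le path_dist_le ?path_dist_ge//; last exact: polyline_nil.
by move=> l; exact: polyline_ge0.
Qed.

Lemma path_dist_eq0 x y : path_dist x y = 0 -> x = y.
Proof.
move=> xy; apply: realisation_eq; apply/funext => w; apply/eqP.
rewrite -subr_eq0 -normr_le0 -xy; apply: path_dist_ge => l.
exact: polyline_ge_coord.
Qed.

Lemma path_dist_sym x y : path_dist x y = path_dist y x.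
Proof.
by congr inf; apply/seteqP; split=> l; exact: polyline_rev.
Qed.

Lemma path_dist_triangle y x z : path_dist x z <= path_dist x y + path_dist y z.
Proof.
rewrite -lerBlDr; apply: path_dist_ge => l xyl.
rewrite lerBlDr -lerBlDl; apply: path_dist_ge => l' yzl'.
by rewrite lerBlDl path_dist_le//; exact: polyline_cat yzl'.
Qed.

HB.instance Definition _ := gen_eqMixin realisation.
HB.instance Definition _ := gen_choiceMixin realisation.
HB.instance Definition _ := isMetric.Build R realisation
  path_distxx path_dist_eq0 path_dist_sym path_dist_triangle.

End Realisation.

(** * Finite l2 products of metric spaces *)

Section L2Product.
Variables (R : realType) (n : nat).

Definition l2_norm (a : 'I_n -> R) : R := Num.sqrt (\sum_i a i ^+ 2).

Lemma sum_sqr_ge0 (a : 'I_n -> R) : 0 <= \sum_i a i ^+ 2.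
Proof. by apply: sumr_ge0 => i _; exact: sqr_ge0. Qed.

Lemma l2_norm_le (a b : 'I_n -> R) : (forall i, 0 <= a i <= b i) ->
  l2_norm a <= l2_norm b.
Proof.
move=> ab; rewrite ler_sqrt ?sum_sqr_ge0//; apply: ler_sum => i _.
by have /andP[? ?] := ab i; rewrite lerXn2r// nnegrE (le_trans _ (_ : a i <= b i)).
Qed.

Lemma l2_normZ (c : R) (a : 'I_n -> R) : 0 <= c ->
  l2_norm (fun i => c * a i) = c * l2_norm a.
Proof.
move=> c0; rewrite /l2_norm.
under eq_bigr do rewrite exprMn.
by rewrite -mulr_sumr sqrtrM ?sqr_ge0// sqrtr_sqr ger0_norm.
Qed.

Lemma cauchy_schwarz_sum (a b : 'I_n -> R) :
  (\sum_i a i * b i) ^+ 2 <= (\sum_i a i ^+ 2) * (\sum_i b i ^+ 2).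
Proof.
have h : 0 <= \sum_i \sum_j (a i * b j - a j * b i) ^+ 2.
  by apply: sumr_ge0 => i _; apply: sumr_ge0 => j _; exact: sqr_ge0.
suff e : \sum_i \sum_j (a i * b j - a j * b i) ^+ 2 =
  2 * ((\sum_i a i ^+ 2) * (\sum_i b i ^+ 2) - (\sum_i a i * b i) ^+ 2).
  by move: h; rewrite e pmulr_rge0 ?ltr0n// subr_ge0.
have e1 : \sum_i \sum_j (a i ^+ 2 * b j ^+ 2) =
    (\sum_i a i ^+ 2) * (\sum_i b i ^+ 2).
  by rewrite mulr_suml; apply: eq_bigr => i _; rewrite mulr_sumr.
have e2 : \sum_i \sum_j (a j ^+ 2 * b i ^+ 2) =
    (\sum_i a i ^+ 2) * (\sum_i b i ^+ 2) by rewrite exchange_big.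
have e3 : \sum_i \sum_j ((a i * b i) * (a j * b j)) = (\sum_i a i * b i) ^+ 2.
  by rewrite expr2 mulr_suml; apply: eq_bigr => i _; rewrite mulr_sumr.
rewrite mulrBr mulr2n mulrDl mul1r mulrDl mul1r -{1}e1 -e2 -e3 -!big_split/=.
rewrite -sumrB; apply: eq_bigr => i _; rewrite -!big_split/= -sumrB.
by apply: eq_bigr => j _; ring.
Qed.

Lemma l2_norm_triangle (a b : 'I_n -> R) :
  l2_norm (fun i => a i + b i) <= l2_norm a + l2_norm b.
Proof.
have s0 c : 0 <= l2_norm c by exact: sqrtr_ge0.
rewrite -(@ler_pXn2r _ 2)// ?nnegrE ?addr_ge0//.
rewrite sqrrD !sqr_sqrtr ?sum_sqr_ge0//.
rewrite (_ : \sum_i (a i + b i) ^+ 2 =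
  \sum_i a i ^+ 2 + (\sum_i a i * b i) *+ 2 + \sum_i b i ^+ 2); last first.
  rewrite -sumrMnl -!big_split/=; apply: eq_bigr => i _; exact: sqrrD.
rewrite lerD2r lerD2l lerMn2r/=.
rewrite -sqrtrM ?sum_sqr_ge0// (le_trans (ler_norm _))//.
by rewrite -sqrtr_sqr ler_sqrt ?cauchy_schwarz_sum// mulr_ge0 ?sum_sqr_ge0.
Qed.

Variable M : 'I_n -> metricType R.

Definition l2_product := forall i, M i.

Definition l2_dist (x y : l2_product) : R :=
  l2_norm (fun i => mdist (x i) (y i)).

Lemma l2_distxx x : l2_dist x x = 0.
Proof.
rewrite /l2_dist /l2_norm big1 ?sqrtr0// => i _.
by rewrite mdistxx expr0n.
Qed.

Lemma l2_dist_eq0 x y : l2_dist x y = 0 -> x = y.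
Proof.
move=> /eqP; rewrite sqrtr_eq0 => xy; apply: functional_extensionality_dep => i.
have : \sum_i mdist (x i) (y i) ^+ 2 == 0 by rewrite eq_le xy sum_sqr_ge0.
rewrite psumr_eq0; last by move=> j _; exact: sqr_ge0.
move=> /allP/(_ i (mem_index_enum _)); rewrite sqrf_eq0 => /eqP.
exact: mdist_positivity.
Qed.

Lemma l2_dist_sym x y : l2_dist x y = l2_dist y x.
Proof.
by congr l2_norm; apply/funext => i; exact: metric_sym.
Qed.

Lemma l2_dist_triangle y x z : l2_dist x z <= l2_dist x y + l2_dist y z.
Proof.
apply: le_trans (l2_norm_triangle _ _); apply: l2_norm_le => i.
by rewrite mdist_ge0 metric_triangle.
Qed.

HB.instance Definition _ := gen_eqMixin l2_product.
HB.instance Definition _ := gen_choiceMixin l2_product.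
HB.instance Definition _ := isMetric.Build R l2_product
  l2_distxx l2_dist_eq0 l2_dist_sym l2_dist_triangle.

End L2Product.

(** * Isometries of a metric space *)

Section Isometries.
Variables (R : realType) (M : metricType R).

Record Isom := MkIsom {
  isom_fun :> M -> M;
  isom_surj : forall y, exists x, isom_fun x = y;
  isom_dist : forall x y, mdist (isom_fun x) (isom_fun y) = mdist x y
}.

HB.instance Definition _ := gen_eqMixin Isom.
HB.instance Definition _ := gen_choiceMixin Isom.

(* [Isom] with the subspace topology from the maps [M -> M], for the compact
   open topology and for the topology of pointwise convergence *)
Definition Isom_compact_open :=
  initial_topology (isom_fun : Isom -> {compact-open, M -> M}).
Definition Isom_pointwise :=
  initial_topology (isom_fun : Isom -> {ptws M -> M}).

HB.instance Definition _ := Topological.on Isom_compact_open.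
HB.instance Definition _ := Topological.on Isom_pointwise.

End Isometries.

Definition discrete_subset (X : topologicalType) (A : set X) :=
  A `<=` isolated A.

(** * Actions on a metric space *)

Section Actions.
Variables (R : realType) (M : metricType R) (G : Type) (act : G -> M -> M).

Definition metric_bounded (C : set M) :=
  exists x r, C `<=` [set y | mdist x y <= r].

Definition acts_metrically_properly := forall C, metric_bounded C ->
  finite_set [set g | act g @` C `&` C !=set0].

Definition acts_properly := forall C : set M, compact C ->
  finite_set [set g | act g @` C `&` C !=set0].

Definition acts_properly_discontinuously := forall x, exists U,
  [/\ open U, U x & finite_set [set g | U `&` act g @` U !=set0]].

Definition stabiliser (x : M) : set G := [set g | act g x = x].

End Actions.

(** * Products of trees *)

Section TreeProduct.
Variables (R : realType) (n : nat) (T : 'I_n -> tree).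

Definition tree_product : metricType R :=
  l2_product (fun i => realisation R (T i)).

Local Notation P := tree_product.

Definition product_vertex (x : P) := forall i, is_vertex (x i).

(* a closed cube of the product: a product of closed simplices of the factors *)
Definition cube (C : set P) := exists u v : forall i, T i,
  (forall i, simplex (u i) (v i)) /\
  C = [set x | forall i, cell (u i) (v i) (x i)].

(* an isomorphism of cube complexes: a bijection under which cubes correspond to
   cubes, and which is isometric on each of them; that it is then an isometry
   of [P] is [aut_isometry] below *)
Definition is_automorphism (f : P -> P) := [/\ bijective f,
  forall C, cube (f @` C) <-> cube C &
  forall C, cube C ->
    forall x y, C x -> C y -> mdist (f x) (f y) = mdist x y].

Lemma polyline_shift (S : tree) (u v : S) (x z : realisation R S) s :
  adj u v -> cell u v x -> cell u v z -> 0 <= s <= 1 ->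
  exists y, [/\ cell u v y, `|x u - y u| = s * `|x u - z u| &
    `|y u - z u| = (1 - s) * `|x u - z u|].
Proof.
move=> uv [p /andP[p0 p1] xp] [q /andP[q0 q1] zq] /andP[s0 s1].
have nuv : (u == v) = false by apply/negP => /eqP e; rewrite e adj_irr in uv.
pose r := (1 - s) * p + s * q.
have r01 : 0 <= r <= 1.
  apply/andP; split; rewrite /r; first by rewrite addr_ge0// mulr_ge0// subr_ge0.
  have h1 : (1 - s) * p <= 1 - s by rewrite ler_piMr// subr_ge0.
  have h2 : s * q <= s by rewrite ler_piMr.
  by rewrite (le_trans (lerD h1 h2))// subrK.
have ry : exists a b, simplex a b /\
    exists2 t, 0 <= t <= 1 & barycenter u v r = barycenter a b t.
  by exists u, v; split; [rewrite /simplex uv orbT|exists r].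
have e t : barycenter u v t u = 1 - t.
  by rewrite /barycenter eqxx nuv mulr1 mulr0 addr0.
exists (Realisation ry); split; first by exists r.
- rewrite /= xp zq !e -(ger0_norm s0) -normrM; congr `|_|; rewrite /r; ring.
- have s1' : 0 <= 1 - s by rewrite subr_ge0.
  rewrite /= xp zq !e -(ger0_norm s1') -normrM; congr `|_|; rewrite /r; ring.
Qed.

(* polylines with [k] segments *)
Inductive polylineN (S : tree) :
    nat -> realisation R S -> realisation R S -> R -> Prop :=
| polylineN_nil x : polylineN 0 x x 0
| polylineN_cons k u v x y z l : adj u v -> cell u v x -> cell u v y ->
    polylineN k y z l -> polylineN k.+1 x z (`|x u - y u| + l).

Lemma polyline_count (S : tree) (x y : realisation R S) l :
  polyline x y l -> exists k, polylineN k x y l.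
Proof.
elim=> [z|u v {}x {}y z {}l uv xc yc _ [k ih]].
  by exists 0%N; exact: polylineN_nil.
by exists k.+1; exact: polylineN_cons uv xc yc ih.
Qed.

Lemma polylineN_ge0 (S : tree) k (x y : realisation R S) l :
  polylineN k x y l -> 0 <= l.
Proof. by elim=> // *; rewrite addr_ge0. Qed.

Lemma polylineN_inv (S : tree) k (x y : realisation R S) l :
  polylineN k x y l ->
  match k with
  | 0%N => x = y /\ l = 0
  | k'.+1 => exists u v z l', [/\ adj u v, cell u v x, cell u v z,
      polylineN k' z y l' & l = `|x u - z u| + l']
  end.
Proof. by case=> [//|k' u v {}x z {}y l' *]; exists u, v, z, l'. Qed.

(* a map that does not increase distances inside the cubes does not increase
   distances: follow polygonal paths in the factors at constant speeds *)
Section LocalToGlobal.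
Variable f : P -> P.
Hypothesis fP : forall C, cube C ->
  forall x y, C x -> C y -> mdist (f x) (f y) <= mdist x y.

Lemma polylines_le N : forall (k : 'I_n -> nat) (x y : P) (l : 'I_n -> R),
  (\sum_i k i <= N)%N -> (forall i, polylineN (k i) (x i) (y i) (l i)) ->
  mdist (f x) (f y) <= l2_norm l.
Proof.
elim: N => [|N ih] k x y l kN kl.
  have xy : x = y.
    apply: functional_extensionality_dep => i; have := polylineN_inv (kl i).
    suff -> : k i = 0%N by case.
    by apply/eqP; move: kN; rewrite leqn0 sum_nat_eq0 => /forallP/(_ i).
  by rewrite xy mdistxx sqrtr_ge0.
have [k0|] := pselect (forall i, k i = 0%N).
  by apply: (ih k); rewrite ?big1.
move=> /existsNP[i1 /eqP]; rewrite -lt0n => ki1.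
pose dk i0 i := if i == i0 then (k i).-1 else k i.
have dkN i0 : (0 < k i0)%N -> (\sum_i dk i0 i <= N)%N.
  move=> ki0; rewrite -ltnS; apply: leq_trans kN.
  rewrite (bigD1 i0)//= [ltnRHS](bigD1 i0)//= /dk eqxx.
  rewrite (eq_bigr k); last by move=> i /negbTE ->.
  by rewrite -addSn prednK.
have kseg i : (0 < k i)%N -> exists u v z l', [/\ adj u v, cell u v (x i),
    cell u v z, polylineN (k i).-1 z (y i) l' & l i = `|x i u - z u| + l'].
  by have := polylineN_inv (kl i); case: (k i).
have [[i [ki [u [v [z [l' [[uv xc zc zy liE] a0]]]]]]]|apos] := pselect (exists i,
    (0 < k i)%N /\ exists u v z l', [/\ adj u v, cell u v (x i),
    cell u v z, polylineN (k i).-1 z (y i) l' & l i = `|x i u - z u| + l'] /\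
    x i u = z u).
  have xz : x i = z.
    apply: realisation_eq; apply/funext => w; apply/eqP.
    rewrite -subr_eq0 -normr_le0 (le_trans (cell_coord w uv xc zc))//.
    by rewrite a0 subrr normr0.
  apply: (ih (dk i)); first exact: dkN.
  move=> j; rewrite /dk; case: eqVneq => [->|_]; last exact: kl.
  by rewrite liE a0 subrr normr0 add0r xz.
have /choice[a aP] : forall i, exists a, (0 < k i)%N ->
    exists u v z l', [/\ adj u v, cell u v (x i),
    cell u v z, polylineN (k i).-1 z (y i) l' & l i = `|x i u - z u| + l'] /\
    a = `|x i u - z u|.
  move=> i; case: (posnP (k i)) => [->|ki]; first by exists 0.
  have [u [v [z [l' h]]]] := kseg i ki.
  by exists `|x i u - z u| => _; exists u, v, z, l'.
have a0 i : (0 < k i)%N -> 0 < a i.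
  move=> ki; have [u [v [z [l' [h ->]]]]] := aP i ki.
  rewrite normr_gt0 subr_eq0; apply/eqP => xz; apply: apos.
  by exists i; split => //; exists u, v, z, l'.
have al i : (0 < k i)%N -> a i <= l i.
  move=> ki; have [u [v [z [l' [[_ _ _ zy ->] ->]]]]] := aP i ki.
  by rewrite lerDl (polylineN_ge0 zy).
have l0 i : (0 < k i)%N -> 0 < l i.
  by move=> ki; rewrite (lt_le_trans (a0 i ki))// al.
have [i0 ki0 imin] : exists2 i0, (0 < k i0)%N &
    forall i, (0 < k i)%N -> a i0 / l i0 <= a i / l i.
  by case: (@arg_minP _ _ _ i1 (fun i => (0 < k i)%N) (fun i => a i / l i) ki1) => i0;
    exists i0.
set t := a i0 / l i0 in imin.
have t0 : 0 <= t by rewrite divr_ge0// ltW// ?a0// l0.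
have t1 : 0 <= 1 - t by rewrite subr_ge0 ler_pdivrMr ?l0// mul1r al.
have step i : exists x' : realisation R (T i),
    [/\ exists u v, [/\ simplex u v, cell u v (x i) & cell u v x'],
        mdist (x i) x' <= t * l i &
        polylineN (dk i0 i) x' (y i) ((1 - t) * l i)].
  case: (posnP (k i)) => [ki|ki].
    exists (x i); rewrite mdistxx /dk.
    have := polylineN_inv (kl i); rewrite ki => -[xy li].
    have -> : (if i == i0 then 0%N.-1 else 0%N) = 0%N by case: ifP.
    rewrite li !mulr0 -xy; split=> //; last exact: polylineN_nil.
    by have [u [v [uv h]]] := baryP (x i); exists u, v.
  have [u [v [z [l' [[uv xc zc zy liE] aE]]]]] := aP i ki.
  have suv : simplex u v by rewrite /simplex uv orbT.
  rewrite /dk; case: (eqVneq i i0) => [e|ni].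
    subst i0; exists z; have tl : t * l i = a i by rewrite /t divfK// gt_eqF// l0.
    rewrite mulrBl mul1r tl liE -aE addrAC subrr add0r; split=> //.
      by exists u, v.
    by rewrite aE; exact/path_dist_le/(polyline_edge uv).
  pose s := t * l i / a i.
  have s01 : 0 <= s <= 1.
    have [la aa] := (ltW (l0 i ki), ltW (a0 i ki)).
    apply/andP; split; first by rewrite /s divr_ge0// mulr_ge0.
    by rewrite /s ler_pdivrMr ?a0// mul1r -ler_pdivlMr ?l0// imin.
  have sa : s * a i = t * l i by rewrite /s divfK// gt_eqF// a0.
  have [x' [x'c xx' x'z]] := polyline_shift uv xc zc s01.
  exists x'; split; first by exists u, v.
    by rewrite -sa aE -xx'; exact/path_dist_le/(polyline_edge uv).
  have -> : (1 - t) * l i = `|x' u - z u| + l'.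
    by rewrite x'z -aE !mulrBl sa !mul1r {1}liE -aE addrAC.
  by rewrite -(prednK ki); exact: polylineN_cons uv x'c zc zy.
pose x' : P := fun i => sval (cid (step i)).
have x'P i : _ := svalP (cid (step i)).
have cxx' i : exists uv : T i * T i,
    [/\ simplex uv.1 uv.2, cell uv.1 uv.2 (x i) & cell uv.1 uv.2 (x' i)].
  by have [[u [v h]] _ _] := x'P i; exists (u, v).
have Lt : l2_norm l = t * l2_norm l + (1 - t) * l2_norm l by ring.
rewrite (le_trans (metric_triangle _ (f x') _))// Lt -!l2_normZ// lerD//.
- apply: le_trans (_ : mdist x x' <= _).
    apply: (@fP [set z : P | forall i, cell (sval (cid (cxx' i))).1
        (sval (cid (cxx' i))).2 (z i)]).
    + exists (fun i => (sval (cid (cxx' i))).1),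
        (fun i => (sval (cid (cxx' i))).2); split=> // i.
      by case: cid => ? [].
    + by move=> i; case: cid => ? [].
    + by move=> i; case: cid => ? [].
  apply: l2_norm_le => i; rewrite mdist_ge0 /=.
  by have [] := x'P i.
- apply: (ih (dk i0)); first exact: dkN.
  by move=> i; have [] := x'P i.
Qed.

Lemma local_to_global x y : mdist (f x) (f y) <= mdist x y.
Proof.
apply/ler_addgt0Pr => e e0.
pose c : R := l2_norm (fun _ : 'I_n => 1).
have c0 : 0 <= c by exact: sqrtr_ge0.
have d0 : 0 < e / (c + 1) by rewrite divr_gt0// ltr_wpDl.
have /choice[l lP] : forall i, exists l,
    polyline (x i) (y i) l /\ l <= mdist (x i) (y i) + e / (c + 1).
  by move=> i; have [l] := path_dist_approx (x i) (y i) d0; exists l.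
have /choice[k kP] : forall i, exists k, polylineN k (x i) (y i) (l i).
  by move=> i; have [/polyline_count] := lP i.
apply: le_trans (polylines_le (leqnn _) kP) _.
apply: le_trans (_ : l2_norm (fun i => mdist (x i) (y i) + e / (c + 1) * 1) <= _).
  by apply: l2_norm_le => i; rewrite (polylineN_ge0 (kP i)) mulr1; case: (lP i).
apply: le_trans (l2_norm_triangle _ _) _.
rewrite lerD2l (l2_normZ _ (ltW d0)) -/c mulrAC ler_pdivrMr ?ltr_wpDl//.
by rewrite ler_pM2l// lerDl.
Qed.

End LocalToGlobal.

Record Aut := MkAut {
  aut_fun :> P -> P;
  autP : is_automorphism aut_fun
}.

Lemma aut_eq (f g : Aut) : aut_fun f = aut_fun g -> f = g.
Proof.
case: f g => [f fP] [g gP] /= fg; rewrite {}fg in fP *.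
by congr MkAut; exact: Prop_irrelevance.
Qed.

Lemma id_automorphism : is_automorphism id.
Proof. by split=> [|C|//]; [exists id|rewrite image_id]. Qed.

Lemma comp_automorphism f g :
  is_automorphism f -> is_automorphism g -> is_automorphism (f \o g).
Proof.
move=> [bf cf df] [bg cg dg]; split=> [|C|C cC x y Cx Cy].
- exact: bij_comp.
- by rewrite -image_comp cf cg.
- rewrite /= (df (g @` C)); [exact: dg cC _ _ _ _|exact/cg| |].
  + by exists x.
  + by exists y.
Qed.

Lemma inv_automorphism f g : cancel f g -> cancel g f ->
  is_automorphism f -> is_automorphism g.
Proof.
move=> fg gf [bf cf df].
have fgC C : f @` (g @` C) = C.
  by rewrite image_comp (_ : f \o g = id) ?image_id//; apply/funext => x /=.
split=> [|C|C cC x y Cx Cy]; first by exists f.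
- by rewrite -cf fgC.
- rewrite -[in RHS](gf x) -[in RHS](gf y) (df (g @` C)) => [//| |/=|/=].
  + by apply/cf; rewrite fgC.
  + by exists x.
  + by exists y.
Qed.

Lemma aut_inv_exists (f : Aut) : exists g : Aut, cancel f g /\ cancel g f.
Proof.
have [[g fg gf] _ _] := autP f.
by exists (MkAut (inv_automorphism fg gf (autP f))).
Qed.

Definition aut_one := MkAut id_automorphism.
Definition aut_mul (f g : Aut) := MkAut (comp_automorphism (autP f) (autP g)).
Definition aut_inv (f : Aut) : Aut := sval (cid (aut_inv_exists f)).

Lemma aut_mulA : associative aut_mul.
Proof. by move=> f g h; exact: aut_eq. Qed.
Lemma aut_mul1g : left_id aut_one aut_mul.
Proof. by move=> f; exact: aut_eq. Qed.
Lemma aut_mulg1 : right_id aut_one aut_mul.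
Proof. by move=> f; exact: aut_eq. Qed.
Lemma aut_mulVg : left_inverse aut_one aut_inv aut_mul.
Proof.
move=> f; apply: aut_eq; apply/funext => x /=; rewrite /aut_inv.
by case: cid => g [fg gf] /=; exact: fg.
Qed.
Lemma aut_mulgV : right_inverse aut_one aut_inv aut_mul.
Proof.
move=> f; apply: aut_eq; apply/funext => x /=; rewrite /aut_inv.
by case: cid => g [fg gf] /=; exact: gf.
Qed.

Lemma aut_isometry (f : Aut) x y : mdist (f x) (f y) = mdist x y.
Proof.
have le1 (g : Aut) a b : mdist (g a) (g b) <= mdist a b.
  have [_ _ gP] := autP g.
  by apply: local_to_global => C cC u v Cu Cv; rewrite (gP C).
apply/eqP; rewrite eq_le le1/=.
have [g [fg _]] := aut_inv_exists f.
by rewrite -{1}(fg x) -{1}(fg y) le1.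
Qed.

Lemma aut_surj (f : Aut) y : exists x, f x = y.
Proof. by have [g [_ gf]] := aut_inv_exists f; exists (g y). Qed.

Definition Isom_of_Aut (f : Aut) : Isom P :=
  MkIsom (aut_surj f) (aut_isometry f).

HB.instance Definition _ := gen_eqMixin Aut.
HB.instance Definition _ := gen_choiceMixin Aut.
HB.instance Definition _ := isGroup.Build Aut
  aut_mulA aut_mul1g aut_mulg1 aut_mulVg aut_mulgV.

End TreeProduct.

(* Main.v *)
Require Import Defs.
From HB Require Import structures.
From mathcomp Require Import all_boot all_order all_algebra.
From mathcomp Require Import all_classical all_reals topology.
From mathcomp Require Import ring lra.
Set Implicit Arguments.
Unset Strict Implicit.
Unset Printing Implicit Defensive.
Import Order.TTheory GRing.Theory Num.Theory.
Local Open Scope classical_set_scope.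
Local Open Scope ring_scope.

(** Bounded subsets of [P] are totally bounded. Hence, if only finitely many
    [g] displace each point of some finite set [s] by less than some [e > 0],
    then for all [x] and [r] only finitely many [g] displace [x] by at most [r]:
    two elements of the latter kind whose values on [s] are [e]-close differ by
    one of the former kind. Finite vertex stabilisers provide such [s] and [e],
    namely [s = {v}] and [e = 1] for a vertex [v], because automorphisms permute
    the vertices and distinct vertices are at distance at least 1. So does (v):
    the conditions [d(f p, g p) < e] for [p] in a finite set define a
    neighbourhood basis of [f] in both topologies on [Isom P], so if [id] is
    isolated in [h(G)] some such neighbourhood of [id] contains only the images
    of the finite kernel. *)

(** * Neighbourhoods in the two topologies on the isometries *)

Section IsometryTopologies.
Variables (R : realType) (M : metricType R).
Implicit Types (f g : Isom M) (U : set (Isom M)).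

(** Stated for bare maps, so that it also applies to [id] and to [act g]. *)
Definition isom_close (s : seq M) (e : R) (f g : M -> M) :=
  forall p, p \in s -> mdist (f p) (g p) < e.

(** The filter lives on all maps [M -> M], where both topologies are pulled back from. Its basic
    sets contain isometries only, which gives equicontinuity. *)
Lemma isom_close_filter (f : M -> M) :
  Filter (filter_from [set se : seq M * R | 0 < se.2]
    (fun se => @isom_fun R M @` [set g : Isom M | isom_close se.1 se.2 f g])).
Proof.
apply: filter_from_filter; first by exists ([::], 1) => /=.
move=> [s e] [s' e'] /= e0 e'0; exists (s ++ s', Num.min e e') => /=.
  by rewrite lt_min e0.
move=> _ [g gc <-]; split; exists g => // p ps; have := gc p.
- by rewrite mem_cat ps /= lt_min => /(_ isT)/andP[].
- by rewrite mem_cat ps orbT lt_min => /(_ isT)/andP[].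
Qed.

Lemma nbhs_mdist (x : M) (A : set M) :
  nbhs x A <-> exists2 e, 0 < e & forall y, mdist x y < e -> A y.
Proof.
rewrite -nbhs_ballE; split=> -[e e0 eA]; exists e => //.
- by move=> y xy; apply: eA; rewrite ballEmdist.
- by move=> y; rewrite ballEmdist; exact: eA.
Qed.

Lemma isom_close_ptws_cvg f :
  {ptws, filter_from [set se : seq M * R | 0 < se.2]
    (fun se => @isom_fun R M @` [set g : Isom M | isom_close se.1 se.2 f g])
    --> (f : M -> M)}.
Proof.
have FF := isom_close_filter f.
apply/cvg_sup => p A [_ [[B oB <-] Bfp] BA].
have /nbhs_mdist[e e0 eB] : nbhs (f p) B by exact: open_nbhs_nbhs.
exists ([:: p], e) => // _ [g gc <-]; apply: BA; apply: eB.
by apply: gc; rewrite inE.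
Qed.

(** By equicontinuity, closeness at one point [x] controls a ball around [x] of radius independent
    of the isometry. Compactness of [K] then leaves finitely many points to test. *)
Lemma isom_close_compact_open_cvg f :
  {compact-open, filter_from [set se : seq M * R | 0 < se.2]
    (fun se => @isom_fun R M @` [set g : Isom M | isom_close se.1 se.2 f g])
    --> (f : M -> M)}.
Proof.
have FF := isom_close_filter f.
apply/compact_open_cvgP => K O cK oO fKO.
set F := filter_from _ _ in FF *.
suff : \forall g \near F, K `<=` [set x | O (g x)].
  by apply: filterS => g KO _ [x Kx <-]; exact: KO.
have /compact_near_coveringP := cK; apply=> x Kx.
have /nbhs_mdist[e e0 eO] : nbhs (f x) O.
  by apply: open_nbhs_nbhs; split=> //; apply: fKO; exists x.
have e20 : 0 < e / 2 by rewrite divr_gt0.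
exists ([set y | mdist x y < e / 2],
  @isom_fun R M @` [set g : Isom M | isom_close [:: x] (e / 2) f g]).
  split; first by apply/nbhs_mdist; exists (e / 2).
  by exists ([:: x], e / 2).
move=> [y _] /= [xy [g gc <-]]; apply: eO.
rewrite (splitr e) (le_lt_trans (metric_triangle _ (g x) _))// ltrD//.
  by apply: gc; rewrite inE.
by rewrite isom_dist.
Qed.

Lemma nbhs_pointwiseP f U : nbhs (f : Isom_pointwise M) U <->
  exists s e, 0 < e /\ forall g, isom_close s e f g -> U g.
Proof.
split=> [|[s [e [e0 sU]]]].
  rewrite nbhsE => -[_ [[V oV <-] Vf] VU].
  have [|[s e] /= e0 sV] := @isom_close_ptws_cvg f V.
    exact: open_nbhs_nbhs.
  by exists s, e; split=> // g gc; apply: VU; apply: sV; exists g.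
have nbp p : nbhs (f : Isom_pointwise M)
    [set g | mdist (f p) (isom_fun g p) < e].
  apply: (@initial_continuous (Isom M) {ptws M -> M} (@isom_fun R M) f
    [set k | mdist (f p) (k p) < e]).
  apply: (@proj_continuous M (fun=> M) p f [set y | mdist (f p) y < e]).
  by apply/nbhs_mdist; exists e.
suff : nbhs (f : Isom_pointwise M) [set g | isom_close s e f (isom_fun g)].
  by apply: filterS => g; exact: sU.
elim: s {sU} => [|p s ih]; first by apply: filterE => g q; rewrite in_nil.
apply: filterS (filterI (nbp p) ih) => g [pg sg] q.
by rewrite inE => /predU1P[->//|]; exact: sg.
Qed.

Lemma nbhs_compact_openP f U : nbhs (f : Isom_compact_open M) U <->
  exists s e, 0 < e /\ forall g, isom_close s e f g -> U g.
Proof.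
split.
  rewrite nbhsE => -[_ [[V oV <-] Vf] VU].
  have [|[s e] /= e0 sV] := @isom_close_compact_open_cvg f V.
    exact: open_nbhs_nbhs.
  by exists s, e; split=> // g gc; apply: VU; apply: sV; exists g.
move=> [s [e [e0 sU]]].
have nbp p : nbhs (f : Isom_compact_open M)
    [set g | mdist (f p) (isom_fun g p) < e].
  (* Since [[set p]] is compact, closeness at [p] follows from a sub-basic condition. *)
  pose O := (ball (f p) e)^°.
  have cp : compact [set p] by exact: compact_set1.
  have oO : open O by exact: open_interior.
  pose C := [set k : {compact-open, M -> M} | k @` [set p] `<=` O].
  have fC : nbhs (f : Isom_compact_open M) (@isom_fun R M @^-1` C).
    apply: (@initial_continuous (Isom M) {compact-open, M -> M} (@isom_fun R M)
      f C).
    apply: open_nbhs_nbhs; split; first exact: compact_open_open cp oO.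
    move=> _ [_ -> <-]; apply/nbhs_mdist; exists e => // y.
    by rewrite ballEmdist.
  apply: filterS fC => g /(_ (isom_fun g p) (ex_intro2 _ _ _ erefl erefl)).
  by move=> /interior_subset; rewrite ballEmdist.
suff : nbhs (f : Isom_compact_open M) [set g | isom_close s e f (isom_fun g)].
  by apply: filterS => g; exact: sU.
elim: s {sU} => [|p s ih]; first by apply: filterE => g q; rewrite in_nil.
apply: filterS (filterI (nbp p) ih) => g [pg sg] q.
by rewrite inE => /predU1P[->//|]; exact: sg.
Qed.

Lemma isom_compact_open_pointwise U :
  @open (Isom_compact_open M) U <-> @open (Isom_pointwise M) U.
Proof.
rewrite !openE; split=> Uo f /Uo.
- by move=> /nbhs_compact_openP/nbhs_pointwiseP.
- by move=> /nbhs_pointwiseP/nbhs_compact_openP.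
Qed.

(** Makes finite sets of isometries closed, so that finitely many of them can be removed from a
    neighbourhood. *)
Lemma isom_compact_open_accessible : accessible_space (Isom_compact_open M).
Proof.
move=> f g fg; have [p fgp] : exists p, f p <> isom_fun g p.
  apply/existsNP => fgE; move/eqP: fg; apply.
  case: f g fgE => [f fs fi] [g gs gi] /= fgE.
  have {}fgE : f = g by apply/funext.
  rewrite {}fgE in fs fi *.
  by congr MkIsom; exact: Prop_irrelevance.
have e0 : 0 < mdist (f p) (isom_fun g p) by rewrite mdist_gt0; apply/eqP.
exists (interior (T := Isom_compact_open M)
  [set k | mdist (f p) (isom_fun k p) < mdist (f p) (isom_fun g p)]).
split; first exact: open_interior.
- rewrite inE; apply/nbhs_compact_openP; exists [:: p]; eexists; split.
    exact: e0.
  by move=> k; apply; rewrite inE.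
- by rewrite inE => /interior_subset/=; rewrite ltxx.
Qed.

End IsometryTopologies.

(** * Finite colourings and total boundedness *)

Lemma finite_set_colouring (Y : eqType) (A : set Y) : finite_set A ->
  exists (C : finType) (c : Y -> C), {in A &, injective c}.
Proof.
(* The colour is the position in an enumeration of [A]; elements outside [A] get the extra colour
   [size s]. *)
move=> /finite_seqP[s ->]; exists 'I_(size s).+1, (fun y => inord (index y s)).
move=> x y; rewrite !inE /= => xs ys /(congr1 (@nat_of_ord _)).
rewrite !inordK ?ltnS ?index_size// => /(congr1 (nth x s)).
by rewrite !nth_index.
Qed.

(** Each fibre comes with a point [x] of [A]; in a group this is the element to translate by. *)
Lemma finite_set_fibres (X : Type) (C : finType) (c : X -> C) (A : set X) :
  (forall x, A x -> finite_set [set y | A y /\ c y = c x]) -> finite_set A.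
Proof.
move=> fib; apply: (@sub_finite_set _ _
  (\bigcup_(k in [set: C]) [set y | A y /\ c y = k])) => [x Ax|].
  by exists (c x).
apply: bigcup_finite => // k _.
have [[x [Ax <-]]|no] := pselect (exists x, A x /\ c x = k); first exact: fib.
by rewrite (_ : mkset _ = set0) -?subset0// => x [Ax cx]; apply: no; exists x.
Qed.

(** Total boundedness of balls, phrased by colourings because these combine into tuples, both over
    finitely many points and over the factors of a product. *)
Definition bounded_sets_precompact (R : realType) (M : metricType R) :=
  forall (x : M) (r e : R), 0 < e -> exists (C : finType) (c : M -> C),
  forall y z, mdist x y <= r -> mdist x z <= r -> c y = c z -> mdist y z < e.

(** * Total boundedness of balls in a locally finite tree *)

Section TreeBalls.
Variables (R : realType) (T : tree).
Implicit Types (u v w : T) (x y : realisation R T).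

Fixpoint graph_ball u k : set T :=
  if k is k'.+1 then
    graph_ball u k' `|` \bigcup_(w in graph_ball u k') [set v | adj w v]
  else [set u].

Lemma finite_graph_ball u k : locally_finite T -> finite_set (graph_ball u k).
Proof.
move=> lf; elim: k => [|k ih] /=; first exact: finite_set1.
by rewrite finite_setU; split=> //; apply: bigcup_finite => // w _; exact: lf.
Qed.

Lemma graph_ball_le u k l : (k <= l)%N -> graph_ball u k `<=` graph_ball u l.
Proof.
elim: l => [|l ih]; first by rewrite leqn0 => /eqP->.
rewrite leq_eqVlt => /predU1P[->//|]; rewrite ltnS => /ih kl v /kl.
by left.
Qed.

Lemma graph_ball_exists u v : exists k, `[<graph_ball u k v>].
Proof.
have [p pp <-] := tree_connected u v.
elim/last_ind: p pp => [|p w ih]; first by exists 0%N; apply/asboolP.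
rewrite rcons_path last_rcons => /andP[/ih[k /asboolP uk] pw].
by exists k.+1; apply/asboolP; right; exists (last u p).
Qed.

Definition graph_dist u v : nat := ex_minn (graph_ball_exists u v).

Lemma graph_distP u v k : graph_ball u k v <-> (graph_dist u v <= k)%N.
Proof.
rewrite /graph_dist; case: ex_minnP => m /asboolP um mmin; split.
  by move=> uk; apply: mmin; apply/asboolP.
by move=> mk; exact: graph_ball_le mk _ um.
Qed.

Lemma graph_dist_adj u v w : adj v w ->
  ((graph_dist u w)%:R <= (graph_dist u v)%:R + 1 :> R).
Proof.
move=> vw; rewrite natr1 ler_nat; apply/graph_distP; right; exists v => //.
exact/graph_distP.
Qed.

(** The left-hand side depends on the coordinates alone, so the affine formula does not depend on
    the simplex representing a point. *)
Lemma sum_barycenter (f : T -> R) (s : seq T) u v (t : R) :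
  uniq s -> u \in s -> v \in s ->
  \sum_(w <- s) barycenter u v t w * f w = (1 - t) * f u + t * f v.
Proof.
move=> us.
have pick (c : R) z : z \in s -> \sum_(w <- s) c * (w == z)%:R * f w = c * f z.
  move=> zs; rewrite (bigD1_seq z)//= eqxx mulr1 big1 ?addr0// => w /negbTE ->.
  by rewrite mulr0 mul0r.
move=> ? ?; under eq_bigr do rewrite /barycenter mulrDl.
by rewrite big_split/= !pick.
Qed.

Lemma affine_extension (f : T -> R) : exists F : realisation R T -> R,
  forall x u v t, bary x = barycenter u v t -> F x = (1 - t) * f u + t * f v.
Proof.
have /choice[F FP] : forall x, exists y : R,
    forall u v t, bary x = barycenter u v t -> y = (1 - t) * f u + t * f v.
  move=> x; have [u [v [_ [t _ xt]]]] := baryP x.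
  exists ((1 - t) * f u + t * f v) => u' v' t'; rewrite xt => e.
  (* One list supporting both representations of [x]. *)
  pose s := undup [:: u; v; u'; v'].
  have us : uniq s by exact: undup_uniq.
  have [su [sv [su' sv']]] : u \in s /\ v \in s /\ u' \in s /\ v' \in s.
    by rewrite !mem_undup !inE !eqxx !orbT.
  by rewrite -(sum_barycenter f _ us su sv) e (sum_barycenter f _ us su' sv').
by exists F.
Qed.

(** On an edge the extension has slope at most 1 in absolute value, so its variation along a
    polyline is at most the length. *)
Lemma affine_extension_lipschitz (f : T -> R) (F : realisation R T -> R) :
  (forall u v, adj u v -> `|f u - f v| <= 1) ->
  (forall x u v t, bary x = barycenter u v t ->
    F x = (1 - t) * f u + t * f v) ->
  forall x y, `|F x - F y| <= mdist x y.
Proof.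
move=> f1 FE x y; apply: path_dist_ge => l.
elim=> [z|u v {}x {}y z {}l uv [t t01 xt] [s s01 ys] _ ih].
  by rewrite subrr normr0.
rewrite (le_trans (ler_distD (F y) _ _))// lerD//.
have nuv : (u == v) = false by apply/negP => /eqP e; rewrite e adj_irr in uv.
rewrite (FE _ _ _ _ xt) (FE _ _ _ _ ys) xt ys /barycenter eqxx nuv.
rewrite !mulr1 !mulr0 !addr0.
rewrite (_ : _ - _ = (s - t) * (f u - f v)); last by ring.
rewrite (_ : 1 - t - (1 - s) = s - t); last by ring.
by rewrite normrM ler_piMr// f1.
Qed.

(** The affine extension of the graph distance is 1-Lipschitz, hence bounds the path metric from
    below. *)
Lemma graph_dist_le (o : T) : exists c : R, forall x u v t, simplex u v ->
  0 <= t <= 1 -> bary x = barycenter u v t ->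
  (graph_dist o u)%:R <= mdist (vertex_point R o) x + c /\
  (graph_dist o v)%:R <= mdist (vertex_point R o) x + c.
Proof.
pose f v : R := (graph_dist o v)%:R.
have fS u v : simplex u v -> f u <= f v + 1 /\ f v <= f u + 1.
  move=> /orP[/eqP->|uv]; first by rewrite lerDl.
  by split; apply: graph_dist_adj => //; rewrite adj_sym.
have f1 u v : adj u v -> `|f u - f v| <= 1.
  move=> uv; have [|? ?] := fS u v; first by rewrite /simplex uv orbT.
  by rewrite ler_norml; lra.
have [F FE] := affine_extension f.
(* The first term is the value at the base point; the 1 pays for passing from [x] to an end of its
   simplex. *)
exists (F (vertex_point R o) + 1) => x u v t uv /andP[t0 t1] xt.
have := affine_extension_lipschitz f1 FE (vertex_point R o) x.
rewrite ler_norml => /andP[h _].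
have [uv1 vu1] := fS u v uv.
have Fx := FE _ _ _ _ xt.
by split; nra.
Qed.

(** A point is coloured by its simplex, one of finitely many near [o], and by its position there
    rounded down to a multiple of [1 / K]. *)
Lemma tree_bounded_sets_precompact :
  locally_finite T -> bounded_sets_precompact (realisation R T).
Proof.
move=> lf x0 r e e0; have [o] := tree_inhabited T.
have [b bP] := graph_dist_le o.
have /choice[rep repP] : forall x, exists p : T * T * R,
    [/\ simplex p.1.1 p.1.2, 0 <= p.2 <= 1 &
        bary x = barycenter p.1.1 p.1.2 p.2].
  by move=> x; have [u [v [uv [t t01 xt]]]] := baryP x; exists (u, v, t).
pose K := (Num.truncn e^-1).+1.
have eK : 1 < K%:R * e.
  by rewrite -ltr_pdivrMr// div1r truncnS_gt.
pose N := Num.truncn (mdist (vertex_point R o) x0 + r + b).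
pose key x := ((rep x).1, Num.truncn ((rep x).2 * K%:R)).
(* Rounding has [K.+1] levels, since parameter 1 gives level [K]. *)
have [C [c cI]] : exists (C : finType) (c : T * T * nat -> C),
    {in graph_ball o N `*` graph_ball o N `*` `I_K.+1 &, injective c}.
  by apply: finite_set_colouring; do 2 apply: finite_setX => //;
    exact: finite_graph_ball.
have keyP x : mdist x0 x <= r ->
    key x \in graph_ball o N `*` graph_ball o N `*` `I_K.+1.
  move=> xr; have [uv t01 xt] := repP x; have [bu bv] := bP _ _ _ _ uv t01 xt.
  have xo : mdist (vertex_point R o) x + b <=
      mdist (vertex_point R o) x0 + r + b.
    by rewrite lerD2r (le_trans (metric_triangle _ x0 _))// lerD2l.
  have pos : 0 <= mdist (vertex_point R o) x0 + r + b.
    by rewrite (le_trans _ xo)// (le_trans _ bu).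
  rewrite inE /=; split; [split|].
  - by apply/graph_distP; rewrite truncn_ge_nat// (le_trans bu).
  - by apply/graph_distP; rewrite truncn_ge_nat// (le_trans bv).
  - case/andP: t01 => t0 t1.
    rewrite truncn_lt_nat ?mulr_ge0// (@le_lt_trans _ _ K%:R) ?ltr_nat//.
    by rewrite ler_piMl.
exists C, (c \o key) => y z yr zr /(cI _ _ (keyP _ yr) (keyP _ zr))[].
have [uv /andP[t0 t1] yt] := repP y; have [_ /andP[s0 s1] zs] := repP z.
move=> e1 ts; rewrite -e1 in zs.
move: (rep y).1.1 (rep y).1.2 (rep y).2 (rep z).2 =>
  u v t s in uv t0 t1 yt s0 s1 zs ts *.
(* On a degenerate simplex the parameter is meaningless, but there is only one point. *)
case/orP: uv => [/eqP uv|uv].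
  rewrite -uv in yt zs; suff -> : y = z by rewrite mdistxx.
  by apply: realisation_eq; rewrite yt zs; apply/funext => w;
    rewrite /barycenter; ring.
apply: le_lt_trans (path_dist_le (polyline_edge uv _ _)) _.
- by exists t; rewrite ?t0.
- by exists s; rewrite ?s0.
have nuv : (u == v) = false.
  by apply/negP => /eqP euv; rewrite euv adj_irr in uv.
rewrite yt zs /barycenter eqxx nuv !mulr1 !mulr0 !addr0.
(* Equal truncations force [t * K] and [s * K] to differ by less than 1, and [1 < K * e]. *)
have /andP[h1 h2] := truncn_itv (mulr_ge0 t0 (ler0n R K)).
have /andP[h3 h4] := truncn_itv (mulr_ge0 s0 (ler0n R K)).
rewrite ts -natr1 in h1 h2; rewrite -natr1 in h4.
have K0 : 0 < K%:R :> R by rewrite ltr0n.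
rewrite ltr_norml -(ltr_pM2l K0) -[X in _ && X](ltr_pM2l K0).
by apply/andP; split; lra.
Qed.

End TreeBalls.

(** * Isometric actions with finite displacement sets *)

Section MetricActions.
Variables (R : realType) (M : metricType R) (G : groupType) (act : G -> M -> M).
Hypothesis actM : forall g k x, act (g * k)%g x = act g (act k x).
Hypothesis act_isom : forall g x y, mdist (act g x) (act g y) = mdist x y.

Lemma act_mulVg g k x : act g (act (g^-1 * k)%g x) = act k x.
Proof. by rewrite -actM mulgA mulgV mul1g. Qed.

(* Colour [g] by the cells containing the images [act g p], for [p] in [s]: two
   elements of the same colour differ by an almost trivial one. *)
Lemma finite_bounded_displacement (s : seq M) (e : R) :
  bounded_sets_precompact M -> 0 < e ->
  finite_set [set g | isom_close s e id (act g)] ->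
  forall x r, finite_set [set g | mdist x (act g x) <= r].
Proof.
move=> pM e0 fin x r.
have [C [c cP]] : exists (C : finType) (c : G -> C), forall g k,
    mdist x (act g x) <= r -> mdist x (act k x) <= r -> c g = c k ->
    isom_close s e (act g) (act k).
  elim: s {fin} => [|p s [C1 [c1 ih]]]; first by exists unit, (fun=> tt).
  (* If [act l] moves [x] by at most [r], it keeps [p] within [r + mdist x p] of [x]. *)
  have [C2 [c2 c2P]] := pM x (r + mdist x p) e e0.
  exists (C1 * C2)%type, (fun g => (c1 g, c2 (act g p))) => g k xg xk [e1 e2] q.
  have bd l : mdist x (act l x) <= r -> mdist x (act l p) <= r + mdist x p.
    move=> xl; rewrite (le_trans (metric_triangle _ (act l x) _))//.
    by rewrite act_isom lerD2r.
  rewrite inE => /predU1P[->|]; first by apply: c2P => //; exact: bd.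
  exact: ih.
apply: (finite_set_fibres (c := c)) => g xg.
apply: sub_finite_set (finite_image (fun k => (g * k)%g) fin) => k [xk kg].
exists (g^-1 * k)%g; last by rewrite mulgA mulgV mul1g.
by move=> p ps; rewrite -(act_isom g) act_mulVg; exact: cP.
Qed.

Lemma bounded_displacement_metrically_properly :
  (forall x r, finite_set [set g | mdist x (act g x) <= r]) ->
  acts_metrically_properly act.
Proof.
(* If [y] and [act g y] lie within [r] of [x], then [act g] moves [x] by at most [r + r]. *)
move=> fin C [x [r Cr]]; apply: sub_finite_set (fin x (r + r)).
move=> g [_ [[y Cy <-] Cgy]] /=.
rewrite (le_trans (metric_triangle _ (act g y) _))// lerD//; first exact: Cr.
by rewrite act_isom metric_sym; exact: Cr.
Qed.

Lemma bounded_displacement_properly_discontinuously :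
  (forall x r, finite_set [set g | mdist x (act g x) <= r]) ->
  acts_properly_discontinuously act.
Proof.
move=> fin x; exists (ball x 1)^°; split.
- exact: open_interior.
- exact: nbhsx_ballx.
apply: sub_finite_set (fin x (1 + 1)) => g [z [xz [y xy gyz]]] /=.
move: xz xy; rewrite -{}gyz => /interior_subset + /interior_subset.
rewrite !ballEmdist /= => xgy xy.
rewrite (le_trans (metric_triangle _ (act g y) _))// ltW// ltrD//.
by rewrite act_isom metric_sym.
Qed.

End MetricActions.

(** Each point has a neighbourhood contained in all balls about [x] of large natural radius;
    compactness makes one radius work for all of [C]. *)
Lemma compact_mdist_bounded (R : realType) (M : metricType R) (C : set M) x :
  compact C -> exists r, C `<=` [set y | mdist x y <= r].
Proof.
move=> /compact_near_coveringP cC.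
have [] := cC nat \oo (fun n y => mdist x y <= n%:R) _.
  move=> y Cy; exists ([set z | mdist y z < 1],
    [set n | (Num.truncn (mdist x y + 1) < n)%N]).
    split; first by apply/nbhs_mdist; exists 1.
    by exists (Num.truncn (mdist x y + 1)).+1.
  move=> [z n] /= [yz xn]; rewrite (le_trans (metric_triangle _ y _))//.
  rewrite (@le_trans _ _ (mdist x y + 1)) ?lerD2l ?ltW//.
  by rewrite -truncn_lt_nat// addr_ge0// mdist_ge0.
by move=> n _ /(_ n (leqnn n)) Cn; exists n%:R.
Qed.

(** * Metric and vertices of the product *)

Section TreeProducts.
Variables (R : realType) (n : nat) (T : 'I_n -> tree).
Local Notation P := (tree_product R T).

Lemma mdist_coord (x y : P) i : mdist (x i) (y i) <= mdist x y.
Proof.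
rewrite -[leLHS]ger0_norm ?mdist_ge0// -sqrtr_sqr.
rewrite [leRHS](_ : _ = Num.sqrt (\sum_i mdist (x i) (y i) ^+ 2))//.
rewrite ler_sqrt ?sum_sqr_ge0// (bigD1 i)//= lerDl.
by apply: sumr_ge0 => j _; exact: sqr_ge0.
Qed.

Lemma product_bounded_sets_precompact :
  (forall i, bounded_sets_precompact (realisation R (T i))) ->
  bounded_sets_precompact P.
Proof.
(* Here [b] is the square root of [n]. Coordinate errors below [e / (b + 1)] give a total of at most
   [e * b / (b + 1) < e]; adding 1 also covers [n = 0]. *)
move=> pT x r e e0; pose b : R := l2_norm (fun _ : 'I_n => 1).
have b0 : 0 <= b by exact: sqrtr_ge0.
have d0 : 0 < e / (b + 1) by rewrite divr_gt0// ltr_wpDl.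
pose C i := projT1 (cid (pT i (x i) r _ d0)).
pose c i : realisation R (T i) -> C i :=
  projT1 (cid (projT2 (cid (pT i (x i) r _ d0)))).
have cP i y z : mdist (x i) y <= r -> mdist (x i) z <= r -> c i y = c i z ->
    mdist y z < e / (b + 1).
  exact: (projT2 (cid (projT2 (cid (pT i (x i) r _ d0))))).
exists {dffun forall i, C i}, (fun y : P => [ffun i => c i (y i)]).
move=> y z xy xz /ffunP yz.
apply: (@le_lt_trans _ _ (e / (b + 1) * b)); last first.
  by rewrite mulrAC ltr_pdivrMr ?ltr_wpDl// ltr_pM2l// ltrDl.
rewrite -(l2_normZ _ (ltW d0)).
apply: (l2_norm_le (a := fun i => mdist (y i) (z i))) => i.
rewrite mdist_ge0 mulr1 /= ltW//; apply: cP.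
- exact: le_trans (mdist_coord _ _ _) xy.
- exact: le_trans (mdist_coord _ _ _) xz.
- by have := yz i; rewrite !ffunE.
Qed.

Lemma cell_vertex (S : tree) (u : S) (x : realisation R S) :
  cell u u x -> x = vertex_point R u.
Proof.
move=> [t _ xt]; apply: realisation_eq; rewrite xt; apply/funext => w /=.
by rewrite /barycenter; ring.
Qed.

(** Distinct vertices differ by 1 in a barycentric coordinate, and coordinates are 1-Lipschitz. *)
Lemma vertex_mdist (S : tree) (x y : realisation R S) :
  is_vertex x -> is_vertex y -> mdist x y < 1 -> x = y.
Proof.
move=> [u /cell_vertex ->] [v /cell_vertex ->].
have [->//|uv] := eqVneq u v; rewrite ltNge => /negP[].
apply: path_dist_ge => l /(polyline_ge_coord u); apply: le_trans.
rewrite /= /barycenter eqxx (negbTE uv).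
by rewrite !(mulr0, mul0r, mulr1, addr0, subr0) normr1.
Qed.

Lemma product_vertex_mdist (x y : P) :
  product_vertex x -> product_vertex y -> mdist x y < 1 -> x = y.
Proof.
move=> vx vy xy; apply: functional_extensionality_dep => i.
apply: vertex_mdist; [exact: vx|exact: vy|].
exact: le_lt_trans (mdist_coord _ _ _) xy.
Qed.

Lemma product_vertex_exists : exists x : P, product_vertex x.
Proof.
have o i : exists v : T i, True by have [v] := tree_inhabited (T i); exists v.
exists (fun i => vertex_point R (projT1 (cid (o i)))) => i.
by exists (projT1 (cid (o i))); exact: cell_left.
Qed.

(* A vertex is a cube reduced to a point. *)
Lemma aut_product_vertex (f : Aut R T) (x : P) :
  product_vertex x -> product_vertex (f x).
Proof.
move=> vx; have [_ cf _] := autP f.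
pose u i := projT1 (cid (vx i)).
have xu i : cell (u i) (u i) (x i) := projT2 (cid (vx i)).
pose C := [set y : P | forall i, cell (u i) (u i) (y i)].
have Cx y : C y -> y = x.
  move=> Cy; apply: functional_extensionality_dep => i.
  by rewrite (cell_vertex (Cy i)) (cell_vertex (xu i)).
have /cf[a [b [_ fC]]] : cube C.
  by exists u, u; split=> // i; rewrite /simplex eqxx.
(* The image cube contains a vertex, and its only point is [f x]. *)
have : [set y : P | forall i, cell (a i) (b i) (y i)]
    (fun i => vertex_point R (a i)) by move=> i; exact: cell_left.
rewrite -fC => -[y /Cx -> fx] i.
by exists (a i); rewrite fx; exact: cell_left.
Qed.

End TreeProducts.

(** * Discreteness of the image *)

Section TreeProductActions.
Variables (R : realType) (n : nat) (T : 'I_n -> tree).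
Variables (G : groupType) (h : {multiplicative G -> Aut R T}).
Local Notation P := (tree_product R T).
Let act : G -> P -> P := fun g => h g.

Lemma hom_act_mul g k x : act (g * k)%g x = act g (act k x).
Proof. by rewrite /act gmulfM. Qed.

Lemma hom_one : h 1%g = 1%g.
Proof. by apply: (@mulgI _ (h 1%g)); rewrite -gmulfM !mulg1. Qed.

Lemma hom_eq1 g : (forall x, act g x = x) -> h g = 1%g.
Proof. by move=> gE; apply: aut_eq; apply/funext => x; exact: gE. Qed.

(** If [h k] is close to [h g] at the single point [x], then [g^-1 * k] moves [x] within [U], which
    leaves finitely many [k]. *)
Lemma properly_discontinuous_discrete : acts_properly_discontinuously act ->
  finite_set [set g : G | h g = 1%g] /\
  @discrete_subset (Isom_compact_open P)
    [set Isom_of_Aut (h g) | g in [set: G]].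
Proof.
move=> pd; have [x _] := product_vertex_exists R T.
have [U [oU Ux Ufin]] := pd x; split.
  apply: sub_finite_set Ufin => g /= hg; exists x; split=> //.
  by exists x => //; rewrite /act hg.
move=> _ [g _ <-]; split; first by rewrite inE; exists g.
have /nbhs_mdist[e e0 eU] : nbhs x U by exact: open_nbhs_nbhs.
(* The finitely many elements of the image, other than [h g] itself, to be removed from the
   neighbourhood of [h g]. *)
pose B : set (Isom P) := [set Isom_of_Aut (h (g * k)%g) |
  k in [set k | U `&` act k @` U !=set0]] `\ Isom_of_Aut (h g).
have Bfin : finite_set B by apply: finite_setD; exact: finite_image.
have nB : nbhs (Isom_of_Aut (h g) : Isom_compact_open P) (~` B).
  apply: open_nbhs_nbhs; split; last by case=> _; apply.
  apply: closed_openC.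
  have /accessible_finite_set_closed := @isom_compact_open_accessible R P.
  exact.
have nx : nbhs (Isom_of_Aut (h g) : Isom_compact_open P)
    [set k | mdist (act g x) (isom_fun k x) < e].
  apply/nbhs_compact_openP; exists [:: x], e; split=> // k; apply.
  by rewrite inE.
exists ([set k | mdist (act g x) (isom_fun k x) < e] `&` ~` B).
  exact: filterI nx nB.
apply/seteqP; split=> [f [[/= xk Bk] [k _ kE]]|_ ->]; last first.
  split; last by exists g.
  by split; [exact: nbhs_singleton nx|exact: nbhs_singleton nB].
rewrite -{f}kE in xk Bk *.
apply: contrapT => kg; apply: Bk; split=> //.
exists (g^-1 * k)%g; last by rewrite mulgA mulgV mul1g.
exists (act (g^-1 * k)%g x); split; last by exists x.
apply: eU; rewrite -(aut_isometry (h g)).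
by rewrite [h g (act _ x)](act_mulVg hom_act_mul).
Qed.

Lemma discrete_small_displacement :
  finite_set [set g : G | h g = 1%g] ->
  @discrete_subset (Isom_compact_open P)
    [set Isom_of_Aut (h g) | g in [set: G]] ->
  exists s e, 0 < e /\ finite_set [set g | isom_close s e id (act g)].
Proof.
move=> kerfin disc.
have [|_ [V V1 VE]] := disc (Isom_of_Aut (h 1%g)); first by exists 1%g.
have /nbhs_compact_openP[s [e [e0 sV]]] := V1.
exists s, e; split=> //; apply: sub_finite_set kerfin => g gs /=.
have /(congr1 (@isom_fun _ _)) : Isom_of_Aut (h g) = Isom_of_Aut (h 1%g).
  have : [set Isom_of_Aut (h 1%g)] (Isom_of_Aut (h g)) => //.
  rewrite -VE; split; last by exists g.
  by apply: sV => p ps /=; rewrite hom_one; exact: gs.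
move=> /= gE; apply: hom_eq1 => x.
by rewrite /act gE hom_one.
Qed.

End TreeProductActions.

(** * The cycle of implications *)

Theorem corollary4p2 (R : realType) (n : nat) (T : 'I_n -> tree)
    (T_lf : forall i, locally_finite (T i))
    (G : groupType) (h : {multiplicative G -> Aut R T}) :
  let P := tree_product R T in
  let act : G -> P -> P := fun g => h g in
  [<-> acts_metrically_properly act;
       acts_properly act;
       forall v : P, product_vertex v -> finite_set (stabiliser act v);
       acts_properly_discontinuously act;
       finite_set [set g : G | h g = 1%g] /\
       @discrete_subset (Isom_compact_open P)
         [set Isom_of_Aut (h g) | g in [set: G]]]
  /\ (forall U : set (Isom P),
        @open (Isom_compact_open P) U <-> @open (Isom_pointwise P) U).
Proof.
move=> P act; split; last exact: isom_compact_open_pointwise.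
have actM g k x : act (g * k)%g x = act g (act k x) by exact: hom_act_mul.
have acti g x y : mdist (act g x) (act g y) = mdist x y by exact: aut_isometry.
have pP : bounded_sets_precompact P.
  apply: product_bounded_sets_precompact => i.
  exact: tree_bounded_sets_precompact.
have [x0 vx0] := product_vertex_exists R T.
tfae.
- move=> mp C cC; apply: mp.
  by have [r Cr] := compact_mdist_bounded x0 cC; exists x0, r.
- move=> ap v vv; have /ap : compact [set v] by exact: compact_set1.
  by apply: sub_finite_set => g gv; exists v; split=> //; exists v.
- move=> stab; apply: (bounded_displacement_properly_discontinuously acti).
  apply: (finite_bounded_displacement (s := [:: x0]) (e := 1) actM acti pP).
    exact: ltr01.
  apply: sub_finite_set (stab x0 vx0) => g gx0.
  apply: product_vertex_mdist; [exact: aut_product_vertex|by []|].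
  by rewrite metric_sym; apply: gx0; rewrite inE.
- exact: properly_discontinuous_discrete.
- move=> [kerfin disc]; apply: (bounded_displacement_metrically_properly acti).
  have [s [e [e0 fin]]] := discrete_small_displacement kerfin disc.
  exact: (finite_bounded_displacement actM acti pP e0 fin).
Qed.
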